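(* Let $d,k\ge1$ and $M\ge 2k$ be integers, let $B\subset\mathbb R^d$ be a closed rectangular box, and let $f\in C^M(B)$. For a mesh size $0<h\le 1$ let $G\subset B$ be a rectangular patch of a Cartesian grid of mesh size $h$, let $H\subset G$ be the hole (the set of grid points where values are unknown), and let $X=G\setminus H$ be the set of known grid points. Let $G_k\subset G$ be the set of grid points at distance at least $k$ grid steps from the boundary of $G$. Let $u_h:G\to\mathbb R$ be a minimizer of $$J(u)=\sum_{i\in G_k}\sum_{j=1}^d\bigl(\Delta_j^{2k}u(i)\bigr)^2$$ over all $u:G\to\mathbb R$ with $u|_X=f|_X$. Let $S_h$ be the set of all pairs $(i,j)$, $i\in G_k$, $1\le j\le d$, such that the stencil of $\Delta_j^{2k}u(i)$ contains at least one point of $H$. Then the following hold. (I) If $H$ is contained in a ball of diameter $qh$, with $q$ fixed (independent of $h$), then $$|S_h|\le C(q,d,k)\qquad\text{and}\qquad \bigl|\Delta_j^{2k}u_h(i)\bigr|\le C\,h^{2k}\quad\text{for all }(i,j)\in S_h .$$ (II) If $H$ is contained in a ball of diameter $D$, independent of $h$, then $$|S_h|\le C(D,d,k)\,h^{-d}\qquad\text{and}\qquad \bigl|\Delta_j^{2k}u_h(i)\bigr|\le C\,h^{2k-d/2}\quad\text{for all }(i,j)\in S_h .$$ Here the constant $C$ depends only on $d$, $k$, $\|f\|_{C^{2k}(B)}$, and on $q$ in case (I), respectively on $D$ in case (II), and is independent of $h$.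
   Context: $\Delta_j^{2k}$ is the (undivided) central difference operator of order $2k$ in the $j$-th coordinate direction: for a grid point $i$ and the grid step vector $h\mathbf e_j$, $$\Delta_j^{2k}u(i)=\sum_{m=0}^{2k}(-1)^m\binom{2k}{m}u\bigl(i+(k-m)h\mathbf e_j\bigr).$$ Its stencil at $i$ is the set of the $2k+1$ grid points $i+m h\mathbf e_j$, $-k\le m\le k$. For $i\in G_k$ all these stencils lie in $G$. $|S_h|$ denotes cardinality. *)

(* Defs.v *)
From HB Require Import structures.
From mathcomp Require Import all_boot all_order all_algebra.
From mathcomp Require Import finmap.
From mathcomp Require Import all_classical all_reals all_analysis.

Set Implicit Arguments.
Unset Strict Implicit.
Unset Printing Implicit Defensive.

Import Order.TTheory GRing.Theory Num.Theory.
Import numFieldNormedType.Exports.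

Local Open Scope classical_set_scope.
Local Open Scope fset_scope.
Local Open Scope ring_scope.

Section Geometry.
Context {R : realType} {d : nat}.
Implicit Types (x y c : 'rV[R]_d) (h : R) (G H : {fset 'rV[R]_d}).

Definition unit_vec (j : 'I_d) : 'rV[R]_d := delta_mx 0 j.

(* The library norm on 'rV[R]_d is the max norm, hence this definition. *)
Definition eucl_dist x y : R := Num.sqrt (\sum_(j < d) (x 0 j - y 0 j) ^+ 2).

Definition in_ball_of_diameter (r : R) H : Prop :=
  exists c, forall x, x \in H -> eucl_dist x c <= r / 2.

Definition box (a b : 'rV[R]_d) : set 'rV[R]_d :=
  [set x | forall j, a 0 j <= x 0 j <= b 0 j].

Definition grid_patch h G : Prop :=
  exists (x0 : 'rV[R]_d) (n : 'I_d -> nat), forall x,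
    x \in G <-> exists z : 'I_d -> nat,
      (forall j, (z j <= n j)%N) /\ x = x0 + h *: \row_j (z j)%:R.

(* The points of G having a neighbour of the infinite grid outside G. *)
Definition grid_boundary h G : {fset 'rV[R]_d} :=
  [fset x in G | [exists j, (x + h *: unit_vec j \notin G)
                         || (x - h *: unit_vec j \notin G)]].

Definition inner_grid (k : nat) h G : {fset 'rV[R]_d} :=
  [fset x in G | [forall y : grid_boundary h G,
                   k%:R * h <= eucl_dist x (val y)]].

End Geometry.

Section Smoothness.
Context {R : realType} {d : nat}.
Implicit Types (B : set 'rV[R]_d) (f : 'rV[R]_d -> R) (x : 'rV[R]_d).

Definition diff_quot f x (j : 'I_d) (t : R) : R :=
  t^-1 * (f (x + t *: unit_vec j) - f x).

(* The increments that keep the moved point in B: derivatives are one-sided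
   where x lies on a face of B orthogonal to the j-th axis, and only the
   values of f on B matter. *)
Definition increments B x (j : 'I_d) : set_system R :=
  within [set t | B (x + t *: unit_vec j)] 0^'.

Definition partial B (j : 'I_d) f : 'rV[R]_d -> R :=
  fun x => lim (diff_quot f x j @ increments B x j).

Definition iter_partial B (w : seq 'I_d) f : 'rV[R]_d -> R :=
  foldr (partial B) f w.

(* All iterated partial derivatives of order at most M, in any order of
   differentiation, exist and are continuous on B. *)
Definition CM (M : nat) B f : Prop :=
  (forall w : seq 'I_d, (size w <= M)%N ->
     {within B, continuous (iter_partial B w f)}) /\
  (forall (w : seq 'I_d) (j : 'I_d) x, (size w < M)%N -> B x ->
     cvg (diff_quot (iter_partial B w f) x j @ increments B x j)).

Definition CM_norm (m : nat) B f : R :=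
  sup [set y | exists (w : seq 'I_d) (x : 'rV[R]_d),
         [/\ (size w <= m)%N, B x & y = `|iter_partial B w f x|]].

End Smoothness.

(* Grid functions are represented by total functions on 'rV[R]_d; only their
   values on G enter in [energy] and [is_minimizer], because the stencils of
   the points of [inner_grid k h G] lie in G. *)
Section Interpolation.
Context {R : realType} {d : nat}.
Implicit Types (h : R) (G H X : {fset 'rV[R]_d}) (f u v : 'rV[R]_d -> R).

Definition stencil_pt (k : nat) h (i : 'rV[R]_d) (j : 'I_d) (m : nat) :
    'rV[R]_d :=
  i + ((k%:R - m%:R) * h) *: unit_vec j.

Definition central_diff (k : nat) h (j : 'I_d) u (i : 'rV[R]_d) : R :=
  \sum_(m < (2 * k).+1)
    (-1) ^+ m * ('C(2 * k, m))%:R * u (stencil_pt k h i j m).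

Definition stencil (k : nat) h (i : 'rV[R]_d) (j : 'I_d) : {fset 'rV[R]_d} :=
  [fset stencil_pt k h i j (val m) | m in 'I_(2 * k).+1].

Definition energy (k : nat) h G u : R :=
  \sum_(i <- inner_grid k h G) \sum_(j < d) (central_diff k h j u i) ^+ 2.

Definition agree_on X u f : Prop := forall x, x \in X -> u x = f x.

Definition is_minimizer (k : nat) h G H f u : Prop :=
  agree_on (G `\` H) u f /\
  forall v, agree_on (G `\` H) v f -> energy k h G u <= energy k h G v.

Definition hole_pairs (k : nat) h G H : {fset 'rV[R]_d * 'I_d} :=
  [fset p in inner_grid k h G `*` [fset j in 'I_d]
     | stencil k h p.1 p.2 `&` H != fset0].

End Interpolation.

(* Main.v *)
(** The datum f is itself admissible, and u and f have the same differences on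
    every stencil avoiding the hole, so minimality reduces to
      sum_S (Delta u)^2 <= sum_S (Delta f)^2 <= |S| (h^2k ||f||_{C^2k})^2,
    S being the set of pairs whose stencil meets the hole; hence each term on the
    left is at most |S|^(1/2) h^2k ||f||_{C^2k} in absolute value.  A hole of
    diameter r has at most (r/h + 1)^d grid points, each of which lies on
    d (2k+1) stencils.  The bound on Delta f is an iterated mean value theorem. *)
Require Import Defs.
From HB Require Import structures.
From mathcomp Require Import all_boot all_order all_algebra.
From mathcomp Require Import finmap.
From mathcomp Require Import all_classical all_reals all_analysis.
From mathcomp Require Import ring lra zify.

Import Order.TTheory GRing.Theory Num.Theory.
Import numFieldNormedType.Exports.
Local Open Scope classical_set_scope.
Local Open Scope fset_scope.
Local Open Scope ring_scope.

(** * One-dimensional tools: backward differences and the iterated mean value theorem *)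

Lemma within_continuous_comp (S T U : topologicalType) (A : set S) (B : set T)
    (phi : S -> T) (g : T -> U) :
  continuous phi -> (forall x, A x -> B (phi x)) ->
  {within B, continuous g} -> {within A, continuous (g \o phi)}.
Proof.
move=> cphi AB /subspace_continuousP cg; apply/subspace_continuousP => x Ax.
apply: cvg_comp (cg _ (AB _ Ax)) => P /= /cphi; rewrite !nbhs_simpl /= => PA.
by move: PA; apply: filterS => y /= PA /AB /PA.
Qed.

(** A central difference of order [2k] is this one taken at the right end of its stencil. The
    one-sided form needs no half steps at odd orders, so the order can drop by one at a time. *)
Definition backward_diff {R : nzRingType} n h (g : R -> R) (t : R) : R :=
  \sum_(m < n.+1) (-1) ^+ m * ('C(n, m))%:R * g (t - m%:R * h).

(** Pascal's rule, followed by a shift of the index in one of the two sums. *)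
Lemma backward_diffS (R : comNzRingType) n h (g : R -> R) t :
  backward_diff n.+1 h g t =
  backward_diff n h (fun s => g s - g (s - h)) t.
Proof.
pose a m := (-1) ^+ m * g (t - m%:R * h).
transitivity (\sum_(m < n.+2) 'C(n.+1, m)%:R * a m).
  by apply: eq_bigr => m _; rewrite /a mulrCA mulrA.
transitivity (\sum_(m < n.+1) 'C(n, m)%:R * a m
              + \sum_(m < n.+1) 'C(n, m)%:R * a m.+1); last first.
  rewrite -big_split; apply: eq_bigr => m _ /=; rewrite /a exprS.
  have -> : t - m.+1%:R * h = t - m%:R * h - h by rewrite -natr1; ring.
  by ring.
rewrite big_ord_recl /= bin0.
under eq_bigr do rewrite /bump /= add1n binS natrD mulrDl.
rewrite big_split addrA /=; congr (_ + _).
(* The extra top term carries the coefficient ['C(n, n.+1)], which is 0. *)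
rewrite big_ord_recr /= bin_small // mul0r addr0 [RHS]big_ord_recl bin0 /=.
by congr (_ + _).
Qed.

(** Here [g] is a chain of successive derivatives. Induction on the order:
    [G m s = g m s - g m (s - h)] is again such a chain, on the interval shortened by [h] at the
    left, and the mean value theorem bounds [G n] by [h * A]. *)
Lemma backward_diff_bound (R : realType) (h A : R) (n : nat) : 0 < h ->
  forall (lo hi : R) (g : nat -> R -> R),
  (forall m, (m < n)%N -> {within `[lo, hi], continuous (g m)}) ->
  (forall m (t : R), (m < n)%N -> lo < t < hi ->
     is_derive t 1 (g m) (g m.+1 t)) ->
  (forall t : R, lo <= t <= hi -> `|g n t| <= A) ->
  forall t : R, lo + n%:R * h <= t <= hi ->
  `|backward_diff n h (g 0%N) t| <= h ^+ n * A.
Proof.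
move=> h0; elim: n A => [|n IHn] A lo hi g gc gd gA t.
  rewrite mul0r addr0 => /gA; rewrite /backward_diff big_ord1 /=.
  by rewrite bin0 expr0 !mul1r mul0r subr0.
move=> tlohi; rewrite backward_diffS exprSr -mulrA.
pose G m s := g m s - g m (s - h).
have shc (m : nat) : (m < n.+1)%N ->
    {within `[lo + h, hi], continuous (fun s => g m (s - h))}.
  move=> mn.
  apply: (@within_continuous_comp _ _ _ _ `[lo, hi] (fun s => s - h)).
  - by move=> s; apply: cvgB; [exact: cvg_id | exact: cvg_cst].
  - by move=> s /=; rewrite !in_itv /=; lra.
  - exact: gc.
have sub : (`[lo + h, hi] `<=` `[lo, hi])%classic.
  by move=> s /=; rewrite !in_itv /=; lra.
apply: (IHn (h * A) (lo + h) hi G) => [m mn|m s mn ls|s ls|].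
- have m1 : (m < n.+1)%N by rewrite ltnS ltnW.
  have /subspace_continuousP c1 := continuous_subspaceW sub (gc _ m1).
  have /subspace_continuousP c2 := shc _ m1.
  by apply/subspace_continuousP => x Ax; apply: cvgB; [exact: c1 | exact: c2].
- have m1 : (m < n.+1)%N by rewrite ltnS ltnW.
  have d1 : is_derive s 1 (g m) (g m.+1 s) by apply: gd => //; lra.
  have d2 : is_derive (s - h) 1 (g m) (g m.+1 (s - h)) by apply: gd => //; lra.
  have d3 : is_derive s (1 : R) (fun x : R => x - h) 1.
    have := is_deriveB (is_derive_id s 1) (is_derive_cst h s 1).
    by rewrite subr0.
  have := @is_derive1_comp _ (g m) (fun x => x - h) s _ _ d2 d3.
  rewrite mulr1 => d4.
  exact: (is_deriveB d1 d4).
- have [|||c] := @MVT R (g n) (g n.+1) (s - h) s.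
  + by lra.
  + by move=> x; rewrite in_itv /= => xs; apply: gd => //; lra.
  + apply: continuous_subspaceW (gc _ (ltnSn n)) => x /=.
    by rewrite !in_itv /=; lra.
  rewrite in_itv /= => cs; rewrite /G => ->.
  have -> : s - (s - h) = h by ring.
  by rewrite normrM (gtr0_norm h0) mulrC ler_pM2l //; apply: gA; lra.
- by move: tlohi; rewrite -natr1; lra.
Qed.

Lemma card_in_injective_leq (K : choiceType) (T : finType) (A : {fset K})
    (f : K -> T) :
  {in A &, injective f} -> (#|` A| <= #|T|)%N.
Proof.
move=> fI; have /card_uniqP := etrans (map_inj_in_uniq fI) (fset_uniq A).
by rewrite size_map => <-; exact: max_card.
Qed.

(** * Derivatives and differences along axis-parallel lines in the box *)

Section Box.
Context {R : realType} {d : nat}.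
Implicit Types (x y a b i : 'rV[R]_d) (h : R) (j : 'I_d).

Lemma unit_vecE j l : @unit_vec R d j 0 l = (l == j)%:R.
Proof. by rewrite /unit_vec mxE eqxx. Qed.

Lemma line_continuous i j : continuous (fun t : R => i + t *: unit_vec j).
Proof.
move=> t; apply: cvgD; first exact: cvg_cst.
by apply: cvgZr_tmp; exact: cvg_id.
Qed.

Lemma box_compact a b : compact (box a b).
Proof.
exact: (@rV_compact R d (fun j => `[a 0 j, b 0 j]%classic)
          (fun j => @segment_compact R (a 0 j) (b 0 j))).
Qed.

(** The supremum is over a bounded set: there are finitely many words of length at most [m], and
    each derivative is continuous on a compact box. *)
Lemma CM_norm_ge (M m : nat) a b f (w : seq 'I_d) x :
  CM M (box a b) f -> (m <= M)%N -> (size w <= m)%N -> box a b x ->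
  `|iter_partial (box a b) w f x| <= CM_norm m (box a b) f.
Proof.
move=> [fc _] mM wm Bx; apply: ub_le_sup; last by exists w, x.
have /choice[C HC] : forall v : m.-bseq 'I_d, exists A : R,
    forall y, box a b y -> `|iter_partial (box a b) v f y| <= A.
  move=> v; have vM : (size v <= M)%N := leq_trans (size_bseq v) mM.
  have := compact_bounded (continuous_compact (fc _ vM) (box_compact a b)).
  case=> A [_ HA]; exists (A + 1) => y By.
  by apply: (HA (A + 1)); [rewrite ltrDl | exists y].
exists (\big[Order.max/0]_(v : m.-bseq 'I_d) C v) => _ [v [y [vm By ->]]].
apply: le_trans (HC (Bseq vm) _ By) _.
exact: le_bigmax.
Qed.

Lemma is_derive_line (M : nat) a b f (w : seq 'I_d) i j t :
  CM M (box a b) f -> (size w < M)%N ->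
  box a b (i + t *: unit_vec j) ->
  a 0 j < i 0 j + t < b 0 j ->
  is_derive t 1 (fun s : R => iter_partial (box a b) w f (i + s *: unit_vec j))
    (iter_partial (box a b) (j :: w) f (i + t *: unit_vec j)).
Proof.
move=> [_ fd] wM Bx ltb; have := fd w j _ wM Bx.
set F := iter_partial _ w f; set x := i + t *: _ in Bx *.
have inc : 0^' --> increments (box a b) x j.
  (* Within the distance to the nearer face orthogonal to the [j]-axis every increment is
     admissible, so the limit is two-sided, even if [x] lies on some other face. *)
  have e0 : 0 < Num.min (i 0 j + t - a 0 j) (b 0 j - (i 0 j + t)).
    by rewrite lt_min; lra.
  have near0 : \forall s \near (0 : R)^', box a b (x + s *: unit_vec j).
    apply: nbhs_dnbhs; apply: filterS (@nbhs0_lt R R^o _ e0) => s /= se l.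
    have := Bx l; rewrite !mxE eqxx /=; case: eqVneq => [->|_] /=.
      by move: se; rewrite !mulr1 lt_min !ltr_norml; lra.
    by rewrite !mulr0 !addr0.
  move=> P; rewrite /increments /within /= => P1.
  by apply: filterS2 near0 P1 => s Bs; exact.
move=> /(cvg_trans (cvg_app (diff_quot F x j) inc)).
rewrite -/(partial (box a b) j F x) => lim0.
have lim1 : (fun s : R => s^-1 *:
    (((fun s : R => F (i + s *: unit_vec j)) \o shift t) (s *: 1) - F x))
    @ 0^' --> partial (box a b) j F x.
  apply: cvg_trans lim0; apply: near_eq_cvg; near=> s.
  rewrite /diff_quot /= /x; congr (_ * (F _ - _)).
  by rewrite -addrA -scalerDl [_ *: 1]mulr1 (addrC t).
by apply: DeriveDef; [apply: cvgP lim1 | exact: cvg_lim lim1].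
Unshelve. all: by end_near. Qed.

(** Only the segment spanned by the stencil matters. It lies in the box with its endpoints, and its
    interior points avoid the faces orthogonal to the [j]-axis even when an endpoint does not. *)
Lemma central_diff_bound (M k : nat) a b f h i j :
  CM M (box a b) f -> (2 * k <= M)%N -> 0 < h ->
  box a b (i + (- (k%:R * h)) *: unit_vec j) ->
  box a b (i + (k%:R * h) *: unit_vec j) ->
  `|central_diff k h j f i| <= h ^+ (2 * k) * CM_norm (2 * k) (box a b) f.
Proof.
move=> fCM kM h0 Bl Br.
pose g m t := iter_partial (box a b) (nseq m j) f (i + t *: unit_vec j).
have -> : central_diff k h j f i = backward_diff (2 * k) h (g 0%N) (k%:R * h).
  by apply: eq_bigr => m _; rewrite /g /= /stencil_pt mulrBl.
have Bt (t : R) :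
    - (k%:R * h) <= t <= k%:R * h -> box a b (i + t *: unit_vec j).
  move=> tk l; move: (Bl l) (Br l); rewrite !mxE eqxx /=.
  by case: (l == j); rewrite /= ?mulr1 ?mulr0 //; lra.
apply: (@backward_diff_bound _ _ _ _ h0 (- (k%:R * h)) (k%:R * h)).
- move=> m mk; apply: (@within_continuous_comp _ _ _ _ (box a b)).
  + exact: line_continuous.
  + by move=> t /=; rewrite in_itv /=; exact: Bt.
  + by apply: fCM.1; rewrite size_nseq; lia.
- move=> m t mk tk; apply: (@is_derive_line M) => //.
  + by rewrite size_nseq; lia.
  + by apply: Bt; lra.
  + by move: (Bl j) (Br j); rewrite !mxE !eqxx /= !mulr1; lra.
- by move=> t /Bt; apply: (@CM_norm_ge M) => //; rewrite size_nseq.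
- by rewrite mul2n -addnn natrD; lra.
Qed.

End Box.

(** * Counting hole points and hole pairs; stencils of inner points *)

Section Grid.
Context {R : realType} {d : nat}.
Implicit Types (x y a b i : 'rV[R]_d) (h r : R) (j : 'I_d).
Implicit Types (G H : {fset 'rV[R]_d}) (f u : 'rV[R]_d -> R).

Lemma eucl_dist_coord x y j : `|x 0 j - y 0 j| <= eucl_dist x y.
Proof.
rewrite -sqrtr_sqr ler_sqrt; last by apply: sumr_ge0 => l _; exact: sqr_ge0.
by rewrite (bigD1 j) //= lerDl; apply: sumr_ge0 => l _; exact: sqr_ge0.
Qed.

Lemma eucl_dist_line x y j :
  (forall l, l != j -> x 0 l = y 0 l) -> eucl_dist x y = `|x 0 j - y 0 j|.
Proof.
move=> xy; rewrite /eucl_dist (bigD1 j) //= big1 ?addr0 ?sqrtr_sqr // => l lj.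
by rewrite xy // subrr expr0n.
Qed.

Lemma card_hole r h G H : 0 < h -> 0 <= r -> grid_patch h G -> H `<=` G ->
  in_ball_of_diameter r H -> (#|` H|)%:R <= (r / h + 1) ^+ d.
Proof.
move=> h0 r0 [x0 [n Gz]] HG [c Hc].
(* The shift by [r / 2] makes the scaled offsets nonnegative, so that truncation is the floor; it
   takes at most [K.+1] values per coordinate. *)
pose s x j := (x 0 j - c 0 j + r / 2) / h.
have s_itv x j : x \in H -> 0 <= s x j <= r / h.
  move=> /Hc /(le_trans (eucl_dist_coord x c j)); rewrite ler_norml => xc.
  by rewrite divr_ge0 ?ler_pM2r ?invr_gt0 //; lra.
pose K := Num.truncn (r / h).
pose F x : {ffun 'I_d -> 'I_K.+1} := [ffun j => inord (Num.truncn (s x j))].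
have FI : {in H &, injective F}.
  move=> x y Hx Hy /ffunP Fxy; apply/rowP => j; move: (Fxy j); rewrite !ffunE.
  move=> /(congr1 val) /=.
  have /andP[sx0 sxr] := s_itv x j Hx; have /andP[sy0 syr] := s_itv y j Hy.
  rewrite !inordK ?ltnS ?le_truncn // => exy.
  have := truncn_itv sx0; have := truncn_itv sy0; rewrite -exy -!natr1.
  have /Gz[zx [_ ex]] := fsubsetP HG _ Hx.
  have /Gz[zy [_ ey]] := fsubsetP HG _ Hy.
  have -> : s x j = s y j + (zx j)%:R - (zy j)%:R.
    by rewrite /s ex ey !mxE; field; rewrite gt_eqF.
  (* Equal floors put the offsets less than 1 apart, while they differ by the integer [zx j - zy j],
     which must be 0. *)
  move=> ty tx; have : (zx j < (zy j).+1)%N by rewrite -(ltr_nat R) -natr1; lra.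
  have : (zy j < (zx j).+1)%N by rewrite -(ltr_nat R) -natr1; lra.
  rewrite !ltnS ex ey !mxE => h1 h2; suff -> : zx j = zy j by [].
  by apply/eqP; rewrite eqn_leq h1 h2.
have := card_in_injective_leq _ _ _ _ FI.
rewrite card_ffun !card_ord -(ler_nat R) => /le_trans; apply.
rewrite natrX lerXn2r ?nnegrE ?ler0n ?addr_ge0 ?divr_ge0 ?(ltW h0) //.
by rewrite -natr1 lerD2r truncn_le divr_ge0 // ltW.
Qed.

(** A hole point, a direction and a position in the stencil determine the centre, so [F] reaches
    every hole pair. *)
Lemma card_hole_pairs k h G H :
  (#|` hole_pairs k h G H| <= #|` H| * d * (2 * k).+1)%N.
Proof.
pose F (p : H * 'I_d * 'I_(2 * k).+1) :=
  (val p.1.1 - ((k%:R - (val p.2)%:R) * h) *: @unit_vec R d p.1.2, p.1.2).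
have sub : {subset hole_pairs k h G H
    <= [seq F p | p <- enum {: H * 'I_d * 'I_(2 * k).+1}]}.
  move=> [i j]; rewrite !inE => /andP[_ /fset0Pn[y]].
  rewrite inE => /andP[/imfsetP[m _ ey] Hy]; apply/mapP.
  exists ([` Hy], j, m); first by rewrite mem_enum.
  by rewrite /F /= ey /= /stencil_pt addrK.
have := uniq_leq_size (fset_uniq _) sub.
by rewrite size_map -cardE !card_prod !card_ord -cardfE.
Qed.

Lemma stencil_pt_grid k h G i j (m : nat) : 0 < h -> grid_patch h G ->
  i \in inner_grid k h G -> (m <= 2 * k)%N -> stencil_pt k h i j m \in G.
Proof.
move=> h0 [x0 [n Gz]]; rewrite !inE => /andP[/Gz[z [zn iz]] /forallP ib] mk.
(* Sliding [i] along the [j]-axis to the face [w] gives a boundary point at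
   distance [h * |z j - w|]. *)
have far (w : nat) (e : R) : (w <= n j)%N -> e = 1 \/ e = -1 ->
    (x0 + h *: \row_l (if l == j then w else z l)%:R + (e * h) *: unit_vec j)
      \notin G ->
    k%:R <= `|(z j)%:R - w%:R : R|.
  move=> wn e1; set y := x0 + _ => yG.
  have yb : y \in grid_boundary h G.
    rewrite !inE; apply/andP; split.
      apply/Gz; exists (fun l => if l == j then w else z l).
      by split=> // l; case: eqP => [->|].
    apply/existsP; exists j; case: e1 yG => ->.
      by rewrite mul1r => ->.
    by rewrite mulN1r scaleNr => ->; rewrite orbT.
  have := ib [` yb]; rewrite /= (@eucl_dist_line _ _ j).
    rewrite iz !mxE eqxx.
    have -> : x0 0 j + h * (z j)%:R - (x0 0 j + h * w%:R)
        = h * ((z j)%:R - w%:R) by ring.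
    by rewrite normrM (gtr0_norm h0) mulrC ler_pM2l.
  by move=> l lj; rewrite iz !mxE (negbTE lj).
(* On the face of index 0 the outward neighbour would have index -1; below, on the face of index
   [n j], it would have index [(n j).+1]. *)
have lo : (k <= z j)%N.
  have := far 0%N (-1) (leq0n _) (or_intror erefl).
  rewrite subr0 normr_nat ler_nat; apply.
  apply/negP => /Gz[z' [_ /rowP/(_ j)]]; rewrite !mxE !eqxx /= => E.
  have : h * ((z' j)%:R + 1) = 0 by lra.
  by apply/eqP; rewrite mulf_neq0 ?gt_eqF // natr1 ltr0n.
have hi : (z j + k <= n j)%N.
  have := far (n j) 1 (leqnn _) (or_introl erefl).
  rewrite distrC -natrB // normr_nat ler_nat => H.
  suff : (k <= n j - z j)%N by have := zn j; lia.
  apply: H; apply/negP => /Gz[z' [/(_ j) z'n /rowP/(_ j)]].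
  rewrite !mxE !eqxx /= => E.
  have : h * ((n j).+1%:R - (z' j)%:R) = 0 by rewrite -natr1; lra.
  by apply/eqP; rewrite mulf_neq0 ?gt_eqF // subr_gt0 ltr_nat ltnS.
(* The natural subtraction is not truncated, as [m <= 2 * k <= z j + k]. *)
apply/Gz; exists (fun l => if l == j then (z j + k - m)%N else z l); split.
  by move=> l; case: eqP => [->|_] //; lia.
apply/rowP => l; rewrite iz /stencil_pt !mxE eqxx /=.
case: eqVneq => [->|_]; last by rewrite mulr0 addr0.
rewrite natrB ?natrD; last by lia.
by rewrite mulr1; ring.
Qed.

End Grid.

(** * Comparison of energies on the hole pairs *)

Section Energy.
Context {R : realType} {d : nat}.
Implicit Types (i : 'rV[R]_d) (h : R) (j : 'I_d).
Implicit Types (G H : {fset 'rV[R]_d}) (f u : 'rV[R]_d -> R).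

(** A single sum over pairs can be split according to whether the stencil meets the hole. *)
Lemma energyE k h G u :
  energy k h G u =
  \sum_(p <- inner_grid k h G `*` [fset j in 'I_d])
    central_diff k h p.2 u p.1 ^+ 2.
Proof.
transitivity (\sum_(p <- [seq (i, j) | i <- inner_grid k h G, j <- enum 'I_d])
    central_diff k h p.2 u p.1 ^+ 2).
  by rewrite big_allpairs; apply: eq_bigr => i _; rewrite big_enum.
apply: perm_big; apply: uniq_perm.
- apply: allpairs_uniq => [||[? ?] [? ?] _ _ [-> ->] //].
  + exact: fset_uniq.
  + exact: enum_uniq.
- exact: fset_uniq.
have jT j : j \in [fset j in 'I_d] by rewrite !inE.
move=> [i j]; rewrite in_fsetM jT andbT; apply/allpairsP/idP.
  by case=> -[x y] /= [xi _ [-> _]].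
by move=> ig; exists (i, j); rewrite /= ig mem_enum.
Qed.

Lemma hole_energy_le k h G H f u : 0 < h -> grid_patch h G ->
  is_minimizer k h G H f u ->
  \sum_(p <- hole_pairs k h G H) central_diff k h p.2 u p.1 ^+ 2 <=
  \sum_(p <- hole_pairs k h G H) central_diff k h p.2 f p.1 ^+ 2.
Proof.
move=> h0 Gp [uf /(_ f (fun _ _ => erefl))].
rewrite !energyE.
pose hits (p : 'rV[R]_d * 'I_d) := stencil k h p.1 p.2 `&` H != fset0.
rewrite (big_fsetID _ hits) [leRHS](big_fsetID _ hits) /=.
set Su := (X in _ + X <= _); set Sf := (X in _ <= _ + X).
suff -> : Su = Sf.
  rewrite lerD2r; congr (is_true (_ <= _)); apply: congr_big => //;
    by apply/fsetP => p; rewrite !inE.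
(* Stencils of inner points stay in [G], so one that avoids [H] consists of known points only. *)
apply: eq_big_seq => -[i j]; rewrite inE => /andP[/=].
rewrite in_fsetM => /andP[/= ig _]; rewrite negbK => /eqP SH.
congr (_ ^+ 2); apply: eq_bigr => m _; congr (_ * _); apply: uf.
have mk : (m <= 2 * k)%N by rewrite -ltnS.
have mG := stencil_pt_grid k h G i j m h0 Gp ig mk.
rewrite in_fsetD mG andbT.
apply/negP => Hm; have : stencil_pt k h i j m \in stencil k h i j `&` H.
  by rewrite in_fsetI Hm andbT; apply/imfsetP; exists m.
by rewrite SH in_fset0.
Qed.

(** A real bound [N] in place of the cardinality lets both kinds of hole share this estimate. *)
Lemma hole_central_diff_bound (M k : nat) (a b : 'rV[R]_d) f h G H u i j N :
  (2 * k <= M)%N -> CM M (box a b) f -> 0 < h -> grid_patch h G ->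
  (forall x, x \in G -> box a b x) -> is_minimizer k h G H f u ->
  (#|` hole_pairs k h G H|)%:R <= N -> (i, j) \in hole_pairs k h G H ->
  `|central_diff k h j u i|
    <= Num.sqrt N * (h ^+ (2 * k) * CM_norm (2 * k) (box a b) f).
Proof.
move=> kM fCM h0 Gp GB umin SN ijS.
set E := h ^+ _ * _.
have fE p : p \in hole_pairs k h G H -> `|central_diff k h p.2 f p.1| <= E.
  rewrite inE => /andP[/=]; rewrite in_fsetM => /andP[pi _] _.
  apply: (central_diff_bound M _ a b) => //; apply: GB.
    have := stencil_pt_grid k h G p.1 p.2 (2 * k) h0 Gp pi (leqnn _).
    by rewrite /stencil_pt mul2n -addnn natrD opprD addrA subrr sub0r mulNr.
  have := stencil_pt_grid k h G p.1 p.2 0%N h0 Gp pi (leq0n _).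
  by rewrite /stencil_pt subr0.
have E0 : 0 <= E := le_trans (normr_ge0 _) (fE _ ijS).
have N0 : 0 <= N := le_trans (ler0n _ _) SN.
(* Both sides become square roots, leaving a comparison of one squared difference with
   [N * E ^+ 2]. *)
rewrite -(ger0_norm E0) -(sqrtr_sqr E) -sqrtrM // -sqrtr_sqr.
rewrite ler_sqrt ?(mulr_ge0 N0 (sqr_ge0 E)) //.
have le1 : central_diff k h j u i ^+ 2 <=
    \sum_(p <- hole_pairs k h G H) central_diff k h p.2 u p.1 ^+ 2.
  rewrite (big_fsetD1 (i, j)) //= lerDl; apply: sumr_ge0 => p _; exact: sqr_ge0.
apply: (le_trans le1).
apply: le_trans (hole_energy_le _ _ _ _ _ _ h0 Gp umin) _.
apply: (@le_trans _ _ (\sum_(p <- hole_pairs k h G H) E ^+ 2)).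
  rewrite big_seq [leRHS]big_seq; apply: ler_sum => p /fE pE.
  by rewrite -real_normK ?num_real // lerXn2r ?nnegrE.
rewrite big_const_seq count_predT iter_addr_0 -[leLHS]mulr_natl.
by rewrite ler_wpM2r ?sqr_ge0.
Qed.

End Energy.

(** * Constants for holes of diameter [q * h] and of fixed diameter *)

Theorem proposition4p1 (R : realType) (d k : nat)
    (hd : (1 <= d)%N) (hk : (1 <= k)%N) :
  exists (N1 N2 : R -> R) (C1 C2 : R -> R -> R),
  forall (M : nat) (a b : 'rV[R]_d) (f : 'rV[R]_d -> R) (h : R)
         (G H : {fset 'rV[R]_d}) (u_h : 'rV[R]_d -> R),
    (2 * k <= M)%N ->
    (forall j, a 0 j < b 0 j) ->
    CM M (box a b) f ->
    0 < h <= 1 ->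
    grid_patch h G ->
    (forall x, x \in G -> box a b x) ->
    H `<=` G ->
    is_minimizer k h G H f u_h ->
    (forall q : R, 0 <= q -> in_ball_of_diameter (q * h) H ->
       (#|` hole_pairs k h G H|)%:R <= N1 q /\
       forall (i : 'rV[R]_d) (j : 'I_d), (i, j) \in hole_pairs k h G H ->
         `|central_diff k h j u_h i|
           <= C1 q (CM_norm (2 * k) (box a b) f) * h ^+ (2 * k)) /\
    (forall D : R, 0 <= D -> in_ball_of_diameter D H ->
       (#|` hole_pairs k h G H|)%:R <= N2 D * h ^- d /\
       forall (i : 'rV[R]_d) (j : 'I_d), (i, j) \in hole_pairs k h G H ->
         `|central_diff k h j u_h i|
           <= C2 D (CM_norm (2 * k) (box a b) f)
              * h `^ ((2 * k)%:R - d%:R / 2)).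
Proof.
(* Hole points for diameter [q * h], times the number of stencils through a point. *)
pose N (q : R) := (q + 1) ^+ d * (d * (2 * k).+1)%:R.
pose C q (A : R) := Num.sqrt (N q) * A.
exists N, N, C, C => M a b f h G H u kM ab fCM /andP[h0 h1] Gp GB HG umin.
have card r : 0 <= r -> in_ball_of_diameter r H ->
    (#|` hole_pairs k h G H|)%:R <= N (r / h).
  move=> r0 Hr; rewrite /N.
  apply: (@le_trans _ _ (#|` H| * (d * (2 * k).+1))%:R).
    by rewrite ler_nat mulnA; exact: card_hole_pairs.
  by rewrite natrM ler_wpM2r // (card_hole _ _ _ _ h0 r0 Gp HG Hr).
have bound A i j (SA : (#|` hole_pairs k h G H|)%:R <= A) :=
  hole_central_diff_bound M k a b f h G H u i j A kM fCM h0 Gp GB umin SA.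
split=> [q q0 Hq|D D0 HD].
  have SN : (#|` hole_pairs k h G H|)%:R <= N q.
    rewrite -[q](mulfK (lt0r_neq0 h0)); apply: card => //.
    by rewrite mulr_ge0 // ltW.
  split=> // i j ijS; rewrite /C -mulrA [_ _ _ * h ^+ _]mulrC.
  exact: bound.
(* Since [h <= 1], [D / h + 1 <= (D + 1) / h]; the [d]-th power gives the factor [h ^- d]. *)
have SN : (#|` hole_pairs k h G H|)%:R <= N D * h ^- d.
  apply: le_trans (card D D0 HD) _.
  rewrite /N mulrAC ler_wpM2r // -exprVn -exprMn lerXn2r ?nnegrE
    ?addr_ge0 ?mulr_ge0 ?divr_ge0 ?invr_ge0 ?(ltW h0) //.
    by rewrite addr_ge0.
  by rewrite mulrDl lerD2l mul1r invf_ge1.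
split=> // i j ijS.
apply: le_trans (bound _ _ _ SN ijS) _.
have N0 : 0 <= N D by rewrite mulr_ge0 // exprn_ge0 // addr_ge0.
(* The loss of [d / 2] in the exponent is the square root of the number of hole pairs. *)
have -> : h `^ ((2 * k)%:R - d%:R / 2) = h ^+ (2 * k) * Num.sqrt (h ^- d).
  rewrite powRB; last by rewrite (gt_eqF h0) implybT.
  rewrite powR_mulrn ?(ltW h0) // powRrM powR12_sqrt ?powR_ge0 //.
  by rewrite powR_mulrn ?(ltW h0) // sqrtrV ?exprn_ge0 ?(ltW h0).
by rewrite sqrtrM // /C -!mulrA ler_wpM2l ?sqrtr_ge0 //
  mulrCA mulrA mulrC.
Qed.
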